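(* Let $\{X_n\}$ be an adversarial Markov chain with data $(\mathcal{X},\eta,P,\pi,D,K,x_0)$ as in the context. Suppose there are $M<\infty$ and a probability measure $\mu_*$ concentrated on $K_{2D}\setminus K_D$ such that: (A1) $P(x,dz)\le M\,\mu_*(dz)$ for all $x\in K_D\setminus K$ and $z\in K_{2D}\setminus K_D$; and (A2) the expected time for a Markov chain following the transitions $P$ to reach the subset $K_D$, when started from the distribution $\mu_*$, is finite. Then $\{X_n\}$ is bounded in probability, i.e. $\lim_{L\to\infty}\sup_{n\in\mathbf{N}}\mathbf{P}(\eta(X_n,\mathbf{0})>L\mid X_0=x_0)=0$.
   Context: Adversarial Markov chain: $\mathcal{X}$ is a nonempty state space with a metric $\eta$, its Borel $\sigma$-algebra $\mathcal{F}$, and a specified origin point $\mathbf{0}\in\mathcal{X}$. $P$ is the transition kernel of a time-homogeneous Markov chain on $\mathcal{X}$ which is Harris ergodic with stationary probability distribution $\pi$: $\lim_{n\to\infty}\sup_{A\in\mathcal{F}}|P^n(x,A)-\pi(A)|=0$ for every $x\in\mathcal{X}$. There is a constant $D<\infty$ with $P(x,\{y\in\mathcal{X}:\eta(x,y)\le D\})=1$ for all $x\in\mathcal{X}$. $K\in\mathcal{F}$ is a fixed bounded nonempty subset; for $r>0$, $K_r$ is the set of all states within distance $r$ of $K$. The adversarial Markov chain is a stochastic process $\{X_n\}_{n\ge 0}$ with $X_0=x_0$ for a specific $x_0\in K$ such that: (i) whenever $X_n\notin K$, $\mathbf{P}(X_{n+1}\in A\mid X_0,\dots,X_n)=P(X_n,A)$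 for all $A\in\mathcal{F}$; (ii) when $X_n\in K$ it may move arbitrarily according to an adversary, possibly depending on $n$ and on the history $X_0,\dots,X_n$ in a nonanticipatory manner, subject only to measurability (the conditional probabilities are well defined) and to the restriction that it cannot move more than a distance $D$ at each iteration, or more specifically that from $K$ it can only move to points of $K_D$. The inequality in (A1) means $P(x,A)\le M\mu_*(A)$ for all measurable $A\subseteq K_{2D}\setminus K_D$ and all $x\in K_D\setminus K$. *)

(* Defs.v *)
From HB Require Import structures.
From mathcomp Require Import all_boot all_order all_algebra.
From mathcomp Require Import all_classical all_reals all_analysis.
From mathcomp Require Import measurable_realfun.

Set Implicit Arguments.
Unset Strict Implicit.
Unset Printing Implicit Defensive.

Import Order.TTheory GRing.Theory Num.Theory.
Import numFieldNormedType.Exports.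

Local Open Scope classical_set_scope.
Local Open Scope ring_scope.

HB.mixin Record Metric_Measurable_isBorel (R : numDomainType)
    (d : measure_display) T & Metric R T & Measurable d T := {
  measurable_borel : @measurable d T = <<s @open T >>
}.

#[short(type="borelMetricType")]
HB.structure Definition BorelMetric (R : numDomainType) (d : measure_display) :=
  { T of Metric R T & Measurable d T & Metric_Measurable_isBorel R d T }.

Section metric_sets.
Context {R : realType} {T : metricType R}.

Definition metric_bounded (K : set T) : Prop :=
  exists r : R, forall x y, K x -> K y -> mdist x y <= r.

(* "Within distance r of K" refers to the point-to-set distance
   inf_{a in K} mdist y a; the set is then closed, hence Borel, which is not
   guaranteed for [set y | exists2 a, K a & mdist y a <= r]. *)
Definition nbhd (K : set T) (r : R) : set T :=
  [set y | (ereal_inf [set (mdist y a)%:E | a in K] <= r%:E)%E].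

End metric_sets.

Section kernels.
Context {R : realType} {d : measure_display} {T : measurableType d}.
Local Open Scope ereal_scope.

Fixpoint kernel_iter (P : R.-pker T ~> T) (n : nat) (x : T) (A : set T)
    : \bar R :=
  if n is m.+1 then \int[P x]_y kernel_iter P m y A else \d_x A.

Definition stationary (P : R.-pker T ~> T) (pi : probability T R) : Prop :=
  forall A, measurable A -> \int[pi]_x P x A = pi A.

Definition harris_ergodic (P : R.-pker T ~> T) (pi : probability T R) : Prop :=
  stationary P pi /\
  forall x, ereal_sup [set `|kernel_iter P n x A - pi A| | A in measurable]
              @[n --> \oo] --> 0.

End kernels.

Section processes.
Context {R : realType} {d d' : measure_display}.
Context {Omega : measurableType d'} (Pr : probability Omega R).
Local Open Scope ereal_scope.

(* Z is a version of the conditional probability of E given the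
   sub-sigma-algebra G. *)
Definition cond_prob_version (G : set (set Omega)) (E : set Omega)
    (Z : Omega -> \bar R) : Prop :=
  [/\ forall B : set (\bar R), measurable B -> G (Z @^-1` B),
      Pr.-integrable setT Z &
      forall H, G H -> \int[Pr]_(w in H) Z w = Pr (E `&` H)].

(* The sigma-algebra generated by X 0, ..., X n. *)
Definition history {T : measurableType d} (X : nat -> {RV Pr >-> T}) (n : nat)
    : set (set Omega) :=
  g_sigma_preimage (fun i : 'I_n.+1 => (X i : Omega -> T)).

Definition markov_chain {T : measurableType d} (P : R.-pker T ~> T)
    (mu : probability T R) (Y : nat -> {RV Pr >-> T}) : Prop :=
  (forall A, measurable A -> distribution Pr (Y 0%N) A = mu A) /\
  forall n A, measurable A ->
    cond_prob_version (history Y n) (Y n.+1 @^-1` A) (fun w => P (Y n w) A).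

Definition hitting_time {T : measurableType d} (Y : nat -> {RV Pr >-> T})
    (S : set T) (w : Omega) : \bar R :=
  ereal_inf [set n%:R%:E | n in [set n : nat | S (Y n w)]].

(* Versions of a conditional probability agree almost surely, so "some version"
   in adversarial_outside is the same as "every version".
   Inside K the next move is unconstrained (it may depend on time, on the past
   and on extra randomness) except that it ends in nbhd K D. *)
Record adversarial_chain {T : borelMetricType R d} (P : R.-pker T ~> T) (D : R)
    (K : set T) (x0 : T) (X : nat -> {RV Pr >-> T}) : Prop := {
  adversarial_init : {ae Pr, forall w, X 0%N w = x0} ;
  adversarial_outside : forall n A, measurable A ->
    exists2 Z, cond_prob_version (history X n) (X n.+1 @^-1` A) Z &
      {ae Pr, forall w, ~ K (X n w) -> Z w = P (X n w) A} ;
  adversarial_inside : forall n,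
    {ae Pr, forall w, K (X n w) -> nbhd K D (X n.+1 w)}
}.

(* For an adversarial chain X 0 = x0 almost surely, so the probability given
   X 0 = x0 is Pr itself. *)
Definition bounded_in_probability {T : borelMetricType R d} (o : T)
    (X : nat -> {RV Pr >-> T}) : Prop :=
  ereal_sup [set Pr [set w | (L < mdist (X n w) o)%R] | n in [set: nat]]
    @[L --> +oo%R] --> 0.

End processes.

(* The law of the hitting time does not depend on which Markov chain with
   initial distribution mu and kernel P is used (one exists by the
   Ionescu-Tulcea theorem), so any realization may be taken. *)
Definition finite_expected_hitting_time {R : realType} {d : measure_display}
    {T : measurableType d} (P : R.-pker T ~> T) (mu : probability T R)
    (S : set T) : Prop :=
  exists (d' : measure_display) (Omega : measurableType d')
    (Pr : probability Omega R) (Y : nat -> {RV Pr >-> T}),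
    markov_chain P mu Y /\ (\int[Pr]_w hitting_time Y S w < +oo)%E.

(* Main.v *)
Require Import Defs.
From HB Require Import structures.
From mathcomp Require Import all_boot all_order all_algebra.
From mathcomp Require Import all_classical all_reals all_analysis.
From mathcomp Require Import measurable_realfun.

(** Let S be the D-neighbourhood of K and U its complement. An adversarial chain
    is unconstrained only inside K, and from K it lands in S; so every time it
    passes from S to U it does so from S \ K, according to P, and by [A1] the
    law of its position on entering U is at most M mu, uniformly over time and
    over the adversary's strategy. As long as it then stays in U it follows P.

    Decomposing according to the last visit to S before time n therefore gives,
    for every nonnegative measurable g,
      E[g(X_n); X_n in U] <= M * sum_(j < n) E[g(Y_j); Y_0, ..., Y_j in U],
    where Y is a Markov chain with kernel P started from mu. This is proved
    without conditioning on the last visit: with Q g(x) = int_U g(y) P(x, dy)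
    ([killed_step]), one step of X gives
      E[g(X_(n+1)); X_(n+1) in U] <= M mu(g; U) + E[Q g(X_n); X_n in U]
    ([adversarial_excursion_step]), which iterates to
    [adversarial_excursions]; and mu(Q^j g; U) is the expectation over the
    killed chain Y ([markov_killed]).

    Taking g to be the indicator of the points farther than L from the origin,
    with L so large that S lies within distance L, bounds P(eta(X_n, 0) > L) by
      M * sum_j P(Y_0, ..., Y_j in U, eta(Y_j, 0) > L),
    uniformly in n. The j-th term tends to 0 as L grows and is dominated by
    P(Y_0, ..., Y_j in U), whose sum over j is the expected hitting time of S,
    finite by [A2]. Dominated convergence for series
    ([dominated_nneseries_cvg0]) concludes. *)

Set Implicit Arguments.
Unset Strict Implicit.
Unset Printing Implicit Defensive.

Import Order.TTheory GRing.Theory Num.Theory.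
Import numFieldNormedType.Exports.

Local Open Scope classical_set_scope.
Local Open Scope ring_scope.

(** * Neighbourhoods of a set in a metric space *)

Section neighbourhoods.
Context {R : realType} {T : metricType R}.
Implicit Types (K : set T) (r e : R) (x y : T).
Local Open Scope ereal_scope.

Lemma nbhd_enlarge K r e x y :
  nbhd K r x -> (mdist x y <= e)%R -> nbhd K (r + e) y.
Proof.
rewrite /nbhd /= => Kx xy; rewrite EFinD -leeBlDr//.
apply: le_trans Kx; apply: le_ereal_inf_tmp => _ [a Ka <-].
rewrite leeBlDr//; apply: ge_ereal_inf; exists (mdist y a)%:E.
  by exists a.
rewrite -EFinD lee_fin (le_trans (metric_triangle _ x _))// addrC lerD2l.
by rewrite metric_sym.
Qed.

(** Distance to K is 1-Lipschitz, so a limit of points of [nbhd K r] lies in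
    [nbhd K (r + e)] for every positive e. *)
Lemma closed_nbhd K r : closed (nbhd K r).
Proof.
move=> y Ky; rewrite /nbhd/=; apply/lee_addgt0Pr => e e0.
have [z [Kz]] := Ky _ (nbhsx_ballx y e e0).
rewrite ballEmdist/= metric_sym => /ltW zy.
by rewrite -EFinD; exact: nbhd_enlarge Kz zy.
Qed.

Lemma nbhd_set1 x r : nbhd [set x] r = [set y | (mdist y x <= r)%R].
Proof.
by apply/seteqP; split => y; rewrite /nbhd/= image_set1 ereal_inf1 lee_fin.
Qed.

Lemma sub_nbhd K r : (0 <= r)%R -> K `<=` nbhd K r.
Proof.
move=> r0 x Kx; apply: ge_ereal_inf; exists (mdist x x)%:E; first by exists x.
by rewrite lee_fin mdistxx.
Qed.

Lemma nbhd_bounded K r x : metric_bounded K -> K x ->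
  exists B, forall y, nbhd K r y -> (mdist y x <= B)%R.
Proof.
move=> [s Ks] Kx; exists (r + 1 + s)%R => y Ky.
have : ereal_inf [set (mdist y a)%:E | a in K] < (r + 1)%:E.
  by rewrite (le_lt_trans Ky)// lte_fin ltrDl.
move=> /ereal_inf_lt[_ [a Ka <-]]; rewrite lte_fin => /ltW ya.
by rewrite (le_trans (metric_triangle _ a _))// lerD// Ks.
Qed.

End neighbourhoods.

Section borel.
Context {R : realType} {d : measure_display} {T : borelMetricType R d}.
Implicit Types (K : set T) (r : R) (o : T).

Lemma measurable_nbhd K r : measurable (nbhd K r).
Proof.
rewrite -[nbhd K r]setCK; apply: measurableC; rewrite measurable_borel.
apply: sub_sigma_algebra; apply: closed_openC; exact: closed_nbhd.
Qed.

Lemma measurable_far o r : measurable [set y | r < mdist y o].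
Proof.
rewrite [X in measurable X](_ : _ = ~` nbhd [set o] r).
  by apply: measurableC; exact: measurable_nbhd.
by rewrite nbhd_set1; apply/seteqP; split => y /=; rewrite ltNge => /negP.
Qed.

Lemma measurable_mdist o : measurable_fun setT (fun y : T => mdist y o).
Proof.
apply: (measurability _ (RGenOInfty.measurableE R)) => /= _ [_ [r ->] <-].
rewrite setTI [X in measurable X](_ : _ = [set y | r < mdist y o]).
  exact: measurable_far.
by apply/seteqP; split => y /=; rewrite in_itv/= andbT.
Qed.

End borel.

(** * Dominated convergence for series of extended reals *)

Section ereal_limits.
Context {R : realType} {I : Type} {F : set_system I} {FF : ProperFilter F}.
Local Open Scope ereal_scope.

Lemma ge0_cvge0 (f : I -> \bar R) : (forall x, 0 <= f x) ->
  (forall e : R, (0 < e)%R -> \forall x \near F, f x <= e%:E) -> f @ F --> 0.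
Proof.
move=> f0 fe; apply/fine_cvgP; split.
  apply: filterS (fe 1%R ltr01) => x fx.
  by rewrite ge0_fin_numE// (le_lt_trans fx)// ltry.
apply/cvgrPdist_le => e e0; apply: filterS (fe e e0) => x fx /=.
rewrite sub0r normrN ger0_norm ?fine_ge0// -lee_fin fineK//.
by rewrite ge0_fin_numE// (le_lt_trans fx)// ltry.
Qed.

Lemma cvge0_near_le J (G : set_system J) (FG : Filter G) (f : J -> \bar R)
    (e : R) :
  f @ G --> 0 -> (0 < e)%R ->
  \forall x \near G, f x <= e%:E.
Proof.
move=> /fine_cvgP[ffin /cvgrPdist_le/(_ e)] + e0 => /(_ e0); apply: filterS2 ffin.
move=> x fx; rewrite /= sub0r normrN => /(le_trans (ler_norm _)).
by rewrite -lee_fin fineK.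
Qed.

(** Only finitely many terms matter up to e / 2, by summability of the bounds
    c; the remaining finite sum tends to 0 term by term. *)
Lemma dominated_nneseries_cvg0 (f : nat -> I -> \bar R) (c : nat -> \bar R) :
  (forall j x, 0 <= f j x) -> (forall j, 0 <= c j) ->
  (forall j x, f j x <= c j) ->
  \sum_(j <oo) c j < +oo -> (forall j, f j @ F --> 0) ->
  (fun x => \sum_(j <oo) f j x) @ F --> 0.
Proof.
move=> f0 c0 fc coo cvgf; apply: ge0_cvge0 => [x|e e0].
  by apply: nneseries_ge0 => j _ _; exact: f0.
have e20 : (0 < e / 2)%R by rewrite divr_gt0.
have [N _ tail_le] : \forall N \near \oo, \sum_(N <= j <oo) c j <= (e / 2)%:E.
  have := nneseries_tail_cvg coo (fun j _ => c0 j).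
  by move=> /cvge0_near_le; apply.
have head_cvg : (fun x => \sum_(0 <= j < N) f j x) @ F --> 0.
  have := @cvg_nnesum _ _ _ _ _ (index_iota 0 N) f (fun=> 0) xpredT
    (fun j _ => nearW _ (f0 j)) (fun j _ => cvgf j).
  by rewrite big1//; exact.
have head_le : \forall x \near F, \sum_(0 <= j < N) f j x <= (e / 2)%:E.
  exact: cvge0_near_le head_cvg e20.
apply: filterS head_le => x head_x.
rewrite (@nneseries_split _ _ 0 N)// add0n (splitr e) EFinD leeD//.
apply: le_trans (tail_le N (leqnn N)).
by apply: lee_nneseries => j *; rewrite ?f0 ?fc.
Qed.

End ereal_limits.

(** * Integrating over one transition of a process *)

Section restricted_measure.
Local Open Scope ereal_scope.
Context {d : measure_display} {T : measurableType d} {R : realType}.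
Variables (m : {measure set T -> \bar R}) (H : set T) (mH : measurable H).

Lemma ge0_integral_mrestr (f : T -> \bar R) :
  (forall x, 0 <= f x) -> measurable_fun setT f ->
  \int[mrestr m mH]_x f x = \int[m]_(x in H) f x.
Proof.
move=> f0 mf; rewrite -(setUv H) ge0_integral_setU//=; first last.
- exact/disj_setPCl.
- by rewrite setUv.
- exact: measurableC.
rewrite [X in _ + X](_ : _ = 0) ?adde0.
  apply: eq_measure_integral => A mA AH; rewrite /= /mrestr.
  by rewrite (setIidl AH).
rewrite (eq_measure_integral mzero) ?integral_measure_zero// => A mA AH.
by rewrite /= /mrestr -[RHS](measure0 m); congr (m _); exact/disjoints_subset.
Qed.

End restricted_measure.

Section transition_kernels.
Context {R : realType} {d : measure_display} {T : measurableType d}.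
Context {d' : measure_display} {Omega : measurableType d'}.
Variable Pr : probability Omega R.
Local Open Scope ereal_scope.

(** The domain [unit] turns the restriction of Pr to H into a kernel, so that
    the theorem on integration against a composition of kernels applies. *)
Definition restricted_kernel (H : set Omega) (mH : measurable H) :
  unit -> {measure set Omega -> \bar R} := fun=> mrestr Pr mH.

Section restricted.
Variables (H : set Omega) (mH : measurable H).

Let measurable_restricted A : measurable A ->
  measurable_fun [set: unit] (restricted_kernel mH ^~ A).
Proof. by move=> _; exact: measurable_cst. Qed.

HB.instance Definition _ :=
  isKernel.Build _ _ _ _ R (restricted_kernel mH) measurable_restricted.

Let restricted_uub : measure_fam_uub (restricted_kernel mH).
Proof.
exists 2%R => -[]; rewrite /= /mrestr setTI.
by rewrite (le_lt_trans (probability_le1 _ mH))// lte1n.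
Qed.

HB.instance Definition _ :=
  Kernel_isFinite.Build _ _ _ _ R (restricted_kernel mH) restricted_uub.

End restricted.

(** The idle [unit] component matches the shape that composition with
    [restricted_kernel] requires. *)
Definition moved_kernel (P : R.-pker T ~> T) (W : {RV Pr >-> T}) :
  unit * Omega -> {measure set T -> \bar R} := fun p => P (W p.2).

Section moved.
Variables (P : R.-pker T ~> T) (W : {RV Pr >-> T}).

Let measurable_moved A : measurable A ->
  measurable_fun setT (moved_kernel P W ^~ A).
Proof.
move=> mA; apply: (measurableT_comp (measurable_kernel P A mA)).
exact: measurableT_comp.
Qed.

HB.instance Definition _ :=
  isKernel.Build _ _ _ _ R (moved_kernel P W) measurable_moved.

Let moved_uub : measure_fam_uub (moved_kernel P W).
Proof. by exists 2%R => -[? ?]; rewrite /= prob_kernel lte1n. Qed.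

HB.instance Definition _ :=
  Kernel_isFinite.Build _ _ _ _ R (moved_kernel P W) moved_uub.

End moved.

(** The hypothesis on P, W and Z is the Markov property at the event H for
    indicators: on H, the conditional law of Z is P (W w). It says that the
    law of Z on H and the composition of Pr on H with P (W w) are the same
    measure, so they integrate every g alike; the restriction of g to U is
    used in order to kill the process outside U. *)
Lemma integral_transition (P : R.-pker T ~> T)
    (W Z : {RV Pr >-> T}) (H : set Omega) (U : set T) (g : T -> \bar R) :
  measurable H -> measurable U ->
  (forall A, measurable A ->
    \int[Pr]_(w in H) P (W w) A = Pr (Z @^-1` A `&` H)) ->
  (forall x, 0 <= g x) -> measurable_fun setT g ->
  \int[Pr]_(w in H `&` Z @^-1` U) g (Z w) =
  \int[Pr]_(w in H) \int[P (W w)]_(y in U) g y.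
Proof.
move=> mH mU HZ g0 mg.
have mgU : measurable_fun setT (g \_ U).
  apply/(measurable_restrictT _ mU).1; exact: measurable_funS mg.
have gU0 y : 0 <= (g \_ U) y by exact: erestrict_ge0.
rewrite integral_mkcondr.
transitivity (\int[Pr]_(w in H) (g \_ U) (Z w)).
  apply: eq_integral => w _; rewrite !patchE.
  by rewrite [in LHS]/in_mem/=.
under [RHS]eq_integral do rewrite integral_mkcond.
transitivity (\int[kcomp (restricted_kernel mH) (moved_kernel P W) tt]_z
    (g \_ U) z); last first.
  rewrite (integral_kcomp _ _ _ gU0 mgU) ge0_integral_mrestr//.
    by move=> w; exact: integral_ge0.
  apply: (@measurable_fun_integral_kernel _ _ _ _ R (fun w => P (W w))) => // A mA.
  exact: measurableT_comp (measurable_kernel P A mA) _.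
transitivity (\int[mrestr Pr mH]_w (g \_ U) (Z w)).
  have mgZ : measurable_fun setT ((g \_ U) \o Z) by apply: measurableT_comp mgU _.
  by rewrite (ge0_integral_mrestr Pr mH (fun w => gU0 (Z w)) mgZ).
have mZ : measurable_fun setT Z by [].
have gUD : {in setT, forall y, 0 <= (g \_ U) y} by move=> y _; exact: gU0.
have := ge0_integral_pushforward mZ (mrestr Pr mH) measurableT mgU gUD.
rewrite preimage_setT => <-.
apply: eq_measure_integral => A mA _.
rewrite /= /kcomp /pushforward ge0_integral_mrestr//; first exact/esym/HZ.
exact: measurableT_comp (measurable_kernel P A mA) _.
Qed.

End transition_kernels.

(** * Histories and the chain killed outside a set *)

Section histories.
Context {R : realType} {d d' : measure_display} {T : measurableType d}.
Context {Omega : measurableType d'} {Pr : probability Omega R}.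
Implicit Types (X : nat -> {RV Pr >-> T}) (A : set T).

Lemma history_preimage X n i A : (i <= n)%N -> measurable A ->
  history X n (X i @^-1` A).
Proof.
move=> ni mA; apply: sub_sigma_algebra.
rewrite -bigcup_mkord_ord; exists i => //.
by exists A => //; rewrite setTI inordK.
Qed.

Lemma history_measurable X n H : history X n H -> measurable H.
Proof.
apply: smallest_sub; first exact: sigma_algebra_measurable.
rewrite -bigcup_mkord_ord => _ [i _ [A mA <-]].
exact: (measurable_funP (X (inord i)) measurableT).
Qed.

Definition stays X (U : set T) n : set Omega :=
  [set w | forall i, (i <= n)%N -> U (X i w)].

Lemma history_stays X (U : set T) n : measurable U ->
  history X n (stays X U n).
Proof.
move=> mU; have -> : stays X U n = \bigcap_(i in `I_n.+1) (X i @^-1` U).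
  by apply/seteqP; split => w /= Uw i; exact: Uw.
rewrite /history /g_sigma_preimage.
set G := \big[_/_]_(_ < _) _.
apply: (@bigcap_measurable _ (g_sigma_algebraType G)); first by exists 0%N.
by move=> i /= ?; exact: history_preimage.
Qed.

Lemma stays0 X U : stays X U 0 = X 0%N @^-1` U.
Proof.
by apply/seteqP; split => [w /(_ 0%N)|w Uw i]; [exact|rewrite leqn0 => /eqP ->].
Qed.

Lemma staysS X U n : stays X U n.+1 = stays X U n `&` X n.+1 @^-1` U.
Proof.
apply/seteqP; split => [w Uw|w [Uw Uw1] i].
  by split => [i /leqW|]; exact: Uw.
by rewrite leq_eqVlt => /predU1P[->|]; [|exact: Uw].
Qed.

End histories.

Section killed.
Context {R : realType} {d : measure_display} {T : measurableType d}.
Local Open Scope ereal_scope.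

(** The sub-Markov operator of the chain killed when it leaves U. *)
Definition killed_step (P : R.-pker T ~> T) (U : set T) (g : T -> \bar R) x :=
  \int[P x]_(y in U) g y.

Variables (P : R.-pker T ~> T) (U : set T).
Hypothesis mU : measurable U.
Implicit Type g : T -> \bar R.

Lemma killed_step_ge0 g :
  (forall x, 0 <= g x) -> forall x, 0 <= killed_step P U g x.
Proof. by move=> g0 x; apply: integral_ge0. Qed.

Lemma measurable_killed_step g : (forall x, 0 <= g x) ->
  measurable_fun setT g -> measurable_fun setT (killed_step P U g).
Proof.
move=> g0 mg; rewrite /killed_step; under eq_fun do rewrite integral_mkcond.
apply: measurable_fun_integral_kernel => [A mA|y|].
- exact: measurable_kernel.
- exact: erestrict_ge0.
- apply/(measurable_restrictT _ mU).1; exact: measurable_funS mg.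
Qed.

End killed.

Section markov.
Context {R : realType} {d d' : measure_display} {T : measurableType d}.
Context {Omega : measurableType d'} {Pr : probability Omega R}.
Local Open Scope ereal_scope.

(** The last step from time n to n + 1 replaces g by its killed step, while the
    event of staying in U up to time n belongs to the history; hence the
    induction on n has to range over all g. *)
Lemma markov_killed (P : R.-pker T ~> T) (mu : probability T R)
    (Y : nat -> {RV Pr >-> T}) (U : set T) (n : nat) (g : T -> \bar R) :
  markov_chain P mu Y -> measurable U ->
  (forall x, 0 <= g x) -> measurable_fun setT g ->
  \int[Pr]_(w in stays Y U n) g (Y n w) =
  \int[mu]_(x in U) iter n (killed_step P U) g x.
Proof.
move=> [Y0 Ystep] mU; elim: n g => [|n IHn] g g0 mg.
  rewrite stays0 /=.
  have mY0 : measurable_fun setT (Y 0%N) by [].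
  have gU : {in U, forall y, 0 <= g y} by move=> y _; exact: g0.
  rewrite -(ge0_integral_pushforward mY0 Pr mU (measurable_funTS mg) gU).
  by apply: eq_measure_integral => A mA _; exact: Y0.
rewrite staysS iterSr -IHn; last 2 first.
- exact: killed_step_ge0.
- exact: measurable_killed_step.
apply: integral_transition => //.
  exact: history_measurable (history_stays mU).
by move=> A mA; case: (Ystep n A mA) => _ _; apply; exact: history_stays.
Qed.

End markov.

(** * Excursions of an adversarial chain away from K *)

Section adversarial.
Context {R : realType} {d d' : measure_display} {T : borelMetricType R d}.
Context {Omega : measurableType d'} {Pr : probability Omega R}.
Local Open Scope ereal_scope.

Variables (P : R.-pker T ~> T) (D : R) (K : set T) (x0 : T).
Variable X : nat -> {RV Pr >-> T}.
Hypothesis mK : measurable K.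
Hypothesis D0 : (0 <= D)%R.
Hypothesis Kx0 : K x0.
Hypothesis advX : adversarial_chain P D K x0 X.
Let U := ~` nbhd K D.
Let mU : measurable U. Proof. exact/measurableC/measurable_nbhd. Qed.

(** The event that the chain is outside K is in its history, and there the
    conditional law of the next state is given by P, whatever happens inside
    K. *)
Lemma adversarial_transition n A : measurable A ->
  \int[Pr]_(w in X n @^-1` (~` K)) P (X n w) A =
  Pr (X n.+1 @^-1` A `&` X n @^-1` (~` K)).
Proof.
move=> mA; have [Z [Zhist Zint Zcond] ZP] := adversarial_outside advX n mA.
have hK : history X n (X n @^-1` (~` K)).
  by apply: history_preimage => //; exact: measurableC.
have mH := history_measurable hK.
rewrite -Zcond//; apply: ae_eq_integral => //.
- apply: measurable_funTS.
  exact: measurableT_comp (measurable_kernel P A mA) _.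
- exact/measurable_funTS/(measurable_int Pr).
- by apply: filterS ZP => w Zw Kw; rewrite Zw.
Qed.

Lemma adversarial_start_inside : Pr (X 0%N @^-1` U) = 0.
Proof.
have [N [mN N0 subN]] := adversarial_init advX.
apply: (subset_measure0 _ mN _ N0).
  by rewrite -[X in measurable X]setTI; exact: measurable_funP.
move=> w Uw; apply: subN => /= Xw; apply: Uw; rewrite Xw.
exact: sub_nbhd.
Qed.

Lemma adversarial_exit_not_from_core n :
  Pr (X n @^-1` K `&` X n.+1 @^-1` U) = 0.
Proof.
have [N [mN N0 subN]] := adversarial_inside advX n.
apply: (subset_measure0 _ mN _ N0).
  by apply: measurableI; rewrite -[X in measurable X]setTI; exact: measurable_funP.
by move=> w [Kw Uw]; apply: subN => /= /(_ Kw).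
Qed.

Variables (M : R) (mu : probability T R).
Hypothesis M0 : (0 <= M)%R.
Hypothesis entrance_dominated : forall x g, (nbhd K D `\` K) x ->
  (forall y, 0 <= g y) -> measurable_fun setT g ->
  killed_step P U g x <= M%:E * \int[mu]_(y in U) g y.

(** Almost surely, a state outside S at time n + 1 was reached from outside K.
    If the state at time n was in S, a new excursion starts and
    [entrance_dominated] bounds its contribution; otherwise the current
    excursion continues under P. *)
Lemma adversarial_excursion_step n g :
  (forall y, 0 <= g y) -> measurable_fun setT g ->
  \int[Pr]_(w in X n.+1 @^-1` U) g (X n.+1 w) <=
  M%:E * \int[mu]_(y in U) g y +
  \int[Pr]_(w in X n @^-1` U) killed_step P U g (X n w).
Proof.
move=> g0 mg.
have mX i (B : set T) : measurable B -> measurable (X i @^-1` B).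
  by move=> mB; rewrite -[X in measurable X]setTI; exact: measurable_funP.
have mgX : measurable_fun setT (g \o X n.+1) by exact: measurableT_comp.
have Q0 := killed_step_ge0 P U g0.
have mQ := measurable_killed_step P mU g0 mg.
have mQX : measurable_fun setT (killed_step P U g \o X n) by exact: measurableT_comp.
have mS : measurable (nbhd K D) by exact: measurable_nbhd.
have c0 : 0 <= M%:E * \int[mu]_(y in U) g y.
  by rewrite mule_ge0//; exact: integral_ge0.
have exit_null := adversarial_exit_not_from_core n.
rewrite (ge0_negligible_integral _ _ _ _ exit_null)//; last 3 first.
- by apply: measurableI; exact: mX.
- exact: mX.
- exact: measurable_funTS mgX.
have -> : X n.+1 @^-1` U `\` (X n @^-1` K `&` X n.+1 @^-1` U) =
    X n @^-1` (~` K) `&` X n.+1 @^-1` U.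
  apply/seteqP; split => [w [Uw KUw]|w [nKw Uw]].
    by split => // Kw; exact: KUw.
  by split => // -[].
rewrite (@integral_transition _ _ _ _ _ Pr P (X n))//; last 2 first.
- exact/mX/measurableC.
- exact: adversarial_transition.
have -> : X n @^-1` (~` K) =
    X n @^-1` (nbhd K D `\` K) `|` X n @^-1` U.
  apply/seteqP; split => [w nKw|w [[]//|nSw Kw]].
    by have [Sw|nSw] := pselect (nbhd K D (X n w)); [left|right].
  exact/nSw/sub_nbhd.
have mSK := mX n _ (measurableD mS mK).
rewrite (ge0_integral_setU Pr mSK (mX n _ mU) (measurable_funTS mQX))//;
  last 2 first.
- by move=> w _; exact: Q0.
- by apply/disj_setPLR => w [Sw _]; exact.
rewrite leeD2r//.
apply: (@le_trans _ _ (\int[Pr]_(w in X n @^-1` (nbhd K D `\` K))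
    (M%:E * \int[mu]_(y in U) g y))).
  apply: ge0_le_integral => //.
  - by move=> w _; exact: Q0.
  - exact: measurable_funTS mQX.
  - by move=> w SKw; exact: entrance_dominated.
rewrite integral_cst//.
rewrite -[leRHS]mule1 lee_wpmul2l//.
exact: probability_le1.
Qed.

(** The j-th term accounts for the excursions away from S that entered U
    exactly j steps before time n. At time 0 there is no excursion, since the chain
    starts in K. *)
Lemma adversarial_excursions n g :
  (forall y, 0 <= g y) -> measurable_fun setT g ->
  \int[Pr]_(w in X n @^-1` U) g (X n w) <=
  M%:E * \sum_(0 <= j < n) \int[mu]_(y in U) iter j (killed_step P U) g y.
Proof.
elim: n g => [|n IHn] g g0 mg.
  rewrite big_geq// mule0 le_eqVlt; apply/orP; left; apply/eqP.
  apply: null_set_integral; last exact: adversarial_start_inside.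
    by rewrite -[X in measurable X]setTI; exact: measurable_funP.
  exact/measurable_funTS/measurableT_comp.
apply: le_trans (adversarial_excursion_step n g0 mg) _.
have i0 j : 0 <= \int[mu]_(y in U) iter j (killed_step P U) g y.
  apply: integral_ge0 => y _.
  by elim: j y => //= j IHj y; exact: killed_step_ge0.
rewrite big_nat_recl// (ge0_muleDr _ (i0 0%N)); last exact: sume_ge0.
rewrite leeD2l//; apply: le_trans.
  apply: IHn; first exact: killed_step_ge0.
  exact: measurable_killed_step.
by rewrite lee_wpmul2l//; apply: lee_sum => j _; rewrite iterSr.
Qed.

End adversarial.

(** * Summability of the survival probabilities *)

(** The integral of a nonnegative function is the supremum over the simple
    functions below it, so it is monotone on all functions; this lets the
    hitting time be compared before it is known to be measurable. *)
Lemma ge0_le_integralT {d : measure_display} {Omega : measurableType d}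
    {R : realType} (m : {measure set Omega -> \bar R}) (f g : Omega -> \bar R) :
  (forall w, 0 <= f w)%E -> (forall w, f w <= g w)%E ->
  (\int[m]_w f w <= \int[m]_w g w)%E.
Proof.
move=> f0 fg; have g0 w : (0 <= g w)%E by exact: le_trans (fg w).
rewrite !ge0_integralE// !patch_setT.
apply: ereal_sup_le => _ [h hf <-]; exists h => // w.
exact: le_trans (fg w).
Qed.

Section hitting.
Context {R : realType} {d d' : measure_display} {T : measurableType d}.
Context {Omega : measurableType d'} {Pr : probability Omega R}.
Local Open Scope ereal_scope.

Variables (Y : nat -> {RV Pr >-> T}) (S : set T).
Hypothesis mS : measurable S.

(** If Y is in S at time n, it fails to stay outside S through any j >= n, so
    at most n terms equal 1. *)
Lemma stays_series_le_hitting w :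
  \sum_(j <oo) (\1_(stays Y (~` S) j) w)%:E <= hitting_time Y S w.
Proof.
apply: le_ereal_inf_tmp => _ [n Sn <-].
rewrite (@nneseries_split _ _ 0 n)//.
rewrite add0n [X in _ + X]eseries0 ?adde0; last first.
  move=> j nj _; rewrite indicE memNset//= => /(_ n nj); exact.
rewrite (@le_trans _ _ (\sum_(0 <= j < n) 1%:E))//.
  by apply: lee_sum => j _; rewrite lee_fin indicE lern1 leq_b1.
by rewrite sumEFin big_const_nat subn0 iter_addr_0 lexx.
Qed.

Lemma stays_summable : \int[Pr]_w hitting_time Y S w < +oo ->
  \sum_(j <oo) Pr (stays Y (~` S) j) < +oo.
Proof.
apply: le_lt_trans.
have mV j : measurable (stays Y (~` S) j).
  exact: history_measurable (history_stays (measurableC mS)).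
have -> : \sum_(j <oo) Pr (stays Y (~` S) j) =
    \int[Pr]_w \sum_(j <oo) (\1_(stays Y (~` S) j) w)%:E.
  rewrite integral_nneseries//.
    by apply: eq_eseriesr => j _; rewrite integral_indic// setIT.
  by move=> j; exact/measurable_EFinP/measurable_indic.
apply: ge0_le_integralT => w; last exact: stays_series_le_hitting.
by apply: nneseries_ge0 => j _ _; rewrite lee_fin.
Qed.

End hitting.

(** * Entering the region away from K *)

Section entrance.
Context {R : realType} {d : measure_display} {T : borelMetricType R d}.
Context (P : R.-pker T ~> T) (D : R) (K : set T).
Hypothesis P_step : forall x, P x [set y | mdist x y <= D] = 1%E.
Local Open Scope ereal_scope.

(** A negative D would make the ball that carries P x empty. *)
Lemma step_ge0 (x : T) : (0 <= D)%R.
Proof.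
rewrite leNgt; apply/negP => D0; have := P_step x.
have -> : [set y | (mdist x y <= D)%R] = set0.
  rewrite -subset0 => y /= xy.
  by have := le_lt_trans xy D0; rewrite ltNge mdist_ge0.
by rewrite measure0 => /eqP; rewrite eq_sym onee_eq0.
Qed.

Lemma step_nbhd r x : nbhd K r x -> P x (~` nbhd K (r + D)) = 0.
Proof.
move=> Kx.
have mB := @measurable_nbhd _ _ T K (r + D).
have PB : P x (nbhd K (r + D)) = 1.
  apply/eqP; rewrite eq_le; apply/andP; split.
    by rewrite -(@prob_kernel _ _ _ _ _ P x) le_measure ?inE.
  rewrite -[leLHS](P_step x) le_measure ?inE//.
    rewrite [X in measurable X](_ : _ = nbhd [set x] D).
      exact: measurable_nbhd.
    by rewrite nbhd_set1; apply/seteqP; split => y /=; rewrite metric_sym.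
  by move=> y /=; exact: nbhd_enlarge.
have : P x (nbhd K (r + D)) + P x (~` nbhd K (r + D)) = 1.
  by rewrite -(@prob_kernel _ _ _ _ _ P x) -(setUv (nbhd K (r + D)))
    measureU//; [exact: measurableC|exact: setICr].
rewrite PB => PC; have : P x (~` nbhd K (r + D)) = 1 - 1.
  by rewrite -[X in _ = X - _]PC (addeC 1) addeK.
by rewrite subee.
Qed.

(** From S the chain reaches at most [nbhd K (2 * D)], so the bound on subsets
    of the shell between S and [nbhd K (2 * D)] controls P x on the whole
    complement of S. The absolute value makes M a legitimate scaling factor
    of the measure mu. *)
Lemma entrance_domination (M : R) (mu : probability T R) :
  (forall x A, (nbhd K D `\` K) x -> measurable A ->
     A `<=` nbhd K (2 * D) `\` nbhd K D -> (P x A <= M%:E * mu A)%E) ->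
  forall x g, (nbhd K D `\` K) x ->
  (forall y, 0 <= g y) -> measurable_fun setT g ->
  killed_step P (~` nbhd K D) g x <= `|M|%:E * \int[mu]_(y in ~` nbhd K D) g y.
Proof.
move=> A1 x g Kx g0 mg; rewrite /killed_step.
have mU : measurable (~` nbhd K D) by exact/measurableC/measurable_nbhd.
have m2D := @measurable_nbhd _ _ T K (2 * D).
rewrite (@eq_measure_integral _ _ _ _ (mrestr (P x) mU)); last first.
  by move=> A mA AU; rewrite /= /mrestr setIidl.
have M0 : (0 <= `|M|)%R by [].
rewrite -(ge0_integral_mscale mu mU (NngNum M0))//; last exact: measurable_funTS.
apply: ge0_le_measure_integral => // A mA; rewrite /mscale/= /mrestr.
set B := A `&` _.
have mB : measurable B by exact: measurableI.
have Bfar : P x (B `\` nbhd K (2 * D)) = 0.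
  apply: (subset_measure0 _ _ _ (step_nbhd Kx.1)).
  - exact: measurableD.
  - exact/measurableC/measurable_nbhd.
  - by move=> y [_]; rewrite mulr_natl mulr2n.
suff : P x B <= `|M|%:E * mu A by [].
have -> : P x B = P x (B `&` nbhd K (2 * D)).
  transitivity (P x (B `\` nbhd K (2 * D)) + P x (B `&` nbhd K (2 * D))).
    exact: measureDI.
  by rewrite Bfar add0e.
apply: (@le_trans _ _ (M%:E * mu (B `&` nbhd K (2 * D)))).
  apply: A1 => //; first exact: measurableI.
  by move=> y [[_ ?] ?]; split.
apply: (@le_trans _ _ (`|M|%:E * mu (B `&` nbhd K (2 * D)))).
  by rewrite lee_wpmul2r// lee_fin ler_norm.
rewrite lee_wpmul2l// le_measure ?inE//; first exact: measurableI.
by move=> y [[]].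
Qed.

End entrance.

(** * Boundedness in probability *)

Lemma cvg_far_prob0 {R : realType} {d d' : measure_display}
  {T : borelMetricType R d} {Omega : measurableType d'}
  {Pr : probability Omega R} (Y : {RV Pr >-> T}) (o : T) :
  (Pr [set w | (r < mdist (Y w) o)%R] @[r --> +oo%R] --> 0)%E.
Proof.
have mY : measurable_fun setT (fun w => mdist (Y w) o).
  exact: measurableT_comp (measurable_mdist o) _.
pose f : {RV Pr >-> R} := HB.pack (fun w => mdist (Y w) o)
  (isMeasurableFun.Build _ _ _ _ _ mY).
apply: cvg_trans (cvg_ccdfy0 f).
apply: near_eq_cvg; apply: nearW => r.
rewrite /ccdf /distribution /pushforward; congr (Pr _).
by apply/seteqP; split => w; rewrite /= in_itv/= andbT.
Qed.

Theorem theorem4 (R : realType) (d : measure_display) (T : borelMetricType R d)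
  (o : T) (P : R.-pker T ~> T) (pi : probability T R) (D : R)
  (K : set T) (x0 : T)
  (d' : measure_display) (Omega : measurableType d') (Pr : probability Omega R)
  (X : nat -> {RV Pr >-> T})
  (P_ergodic : harris_ergodic P pi)
  (P_step : forall x, P x [set y | mdist x y <= D] = 1%E)
  (K_measurable : measurable K)
  (K_bounded : metric_bounded K)
  (K_x0 : K x0)
  (X_adversarial : adversarial_chain P D K x0 X)
  (M : R) (mu : probability T R)
  (mu_concentrated : mu (nbhd K (2 * D) `\` nbhd K D) = 1%E)
  (A1 : forall x A, (nbhd K D `\` K) x -> measurable A ->
     A `<=` nbhd K (2 * D) `\` nbhd K D -> (P x A <= M%:E * mu A)%E)
  (A2 : finite_expected_hitting_time P mu (nbhd K D)) :
  bounded_in_probability o X.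
Proof.
have [d2 [Om [Q [Y [Ychain Yhit]]]]] := A2.
have D0 := step_ge0 P_step x0.
have mS : measurable (nbhd K D) by exact: measurable_nbhd.
have mU := measurableC mS.
set U := ~` nbhd K D in mU.
have mstays j : measurable (stays Y U j).
  exact: history_measurable (history_stays mU).
have mpre e (W : measurableType e) (q : probability W R) (Z : {RV q >-> T}) B :
    measurable B -> measurable (Z @^-1` B).
  by move=> mB; rewrite -[X in measurable X]setTI; exact: measurable_funP.
pose far L := [set y : T | L < mdist y o].
have mfar L : measurable (far L) by exact: measurable_far.
pose tail L j := Q (Y j @^-1` far L `&` stays Y U j).
have [B SB] := nbhd_bounded D K_bounded K_x0.
(* The threshold on L guarantees that points farther than L lie in U, where
   the excursion estimate applies. *)
have farU L : B + mdist x0 o <= L -> far L `<=` U.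
  move=> BL y /= Ly Sy; move: Ly; rewrite /far/= ltNge (le_trans _ BL)//.
  by rewrite (le_trans (metric_triangle _ x0 _))// lerD2r SB.
have bound n L : B + mdist x0 o <= L ->
    (Pr (X n @^-1` far L) <= `|M|%:E * \sum_(j <oo) tail L j)%E.
  move=> BL.
  pose g : T -> \bar R := EFin \o \1_(far L).
  have g0 y : (0 <= g y)%E by rewrite lee_fin.
  have mg : measurable_fun setT g by exact/measurable_EFinP/measurable_indic.
  have -> : Pr (X n @^-1` far L) = (\int[Pr]_(w in X n @^-1` U) g (X n w))%E.
    rewrite (integral_indic Pr (mpre _ _ _ _ _ mU) (mpre _ _ _ _ _ (mfar L))).
    by rewrite -preimage_setI (setIidl (farU L BL)).
  apply: le_trans (adversarial_excursions K_measurable D0 K_x0 X_adversarial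
    (normr_ge0 M) (entrance_domination P_step A1) n g0 mg) _.
  rewrite lee_wpmul2l//.
  apply: le_trans (nneseries_lim_ge n _); last by [].
  apply: lee_sum => j _; rewrite -(markov_killed j Ychain mU g0 mg).
  by rewrite (integral_indic Q (mstays j) (mpre _ _ _ _ _ (mfar L))).
have tail_cvg : (fun L => \sum_(j <oo) tail L j)%E @ +oo%R --> 0%E.
  apply: (@dominated_nneseries_cvg0 _ _ _ _ (fun j L => tail L j)
    (fun j => Q (stays Y U j))) => //.
  - move=> j L; apply: le_measure; rewrite ?inE//.
    by apply: measurableI => //; exact: mpre.
  - exact: stays_summable.
  - move=> j; apply: (@squeeze_cvge _ _ _ _ (cst 0%E) _ _ _ _ (cvg_cst _)
      (cvg_far_prob0 (Y j) o)).
    apply: nearW => L; rewrite measure_ge0/=; apply: le_measure; rewrite ?inE//.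
      by apply: measurableI => //; exact: mpre.
    exact: mpre _ _ _ _ _ (mfar L).
rewrite /bounded_in_probability.
have Mtail_cvg : (fun L => `|M|%:E * \sum_(j <oo) tail L j)%E @ +oo%R --> 0%E.
  by have := cvgeZl (isT : `|M|%:E \is a fin_num) tail_cvg; rewrite mule0.
apply: (squeeze_cvge _ (cvg_cst 0%E) Mtail_cvg).
near=> L; apply/andP; split.
  by apply: le_ereal_sup_tmp; exists (Pr [set w | L < mdist (X 0%N w) o]).
apply: ge_ereal_sup => _ [n _ <-]; apply: bound.
by near: L; apply: nbhs_pinfty_ge; exact: num_real.
Unshelve. all: by end_near. Qed.
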